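(* Let $R$ be a residuated lattice and let $f:\mathrm{Filt}(R)\to\mathrm{Con}(R)$, $f(F)=\{(x,y)\in R^2\mid x\leftrightarrow y\in F\}$, be the canonical bounded lattice isomorphism. Then: (1) For any $F\in\mathrm{Filt}(R)$: $F$ has BLP iff $f(F)$ has BLP iff $f(F)$ has CBLP iff $f(F)$ has FCLP. (2) For any $\phi\in\mathrm{Con}(R)$: $\phi$ has BLP iff $\phi$ has CBLP iff $\phi$ has FCLP. (3) $R$ has BLP iff $R$ has CBLP iff $R$ has FCLP.
   Context: A (commutative) residuated lattice is an algebra $(R,\vee,\wedge,\odot,\rightarrow,0,1)$ such that $(R,\vee,\wedge,0,1)$ is a bounded lattice, $(R,\odot,1)$ is a commutative monoid, and $a\odot b\leq c$ iff $a\leq b\rightarrow c$ for all $a,b,c\in R$. Put $a\leftrightarrow b=(a\rightarrow b)\wedge(b\rightarrow a)$. Residuated lattices are arithmetical algebras (congruence-distributive and congruence-permutable). The complemented elements of the underlying bounded lattice of $R$ have unique complements and form a Boolean sublattice $\mathcal{B}(R)$ of $R$; residuated lattice morphisms map $\mathcal{B}(R)$ into the corresponding Boolean center. A filter of $R$ is a non-empty subset closed under $\odot$ and upward closed; $\mathrm{Filt}(R)$ is the bounded lattice of filters ordered by inclusion. BLP: a congruence $\phi$ of $R$ has BLP (Boolean Lifting Property) if the Boolean morphism $\mathcal{B}(R)\to\mathcal{B}(R/\phi)$, $a\mapsto a/\phi$, is surjective; a filter $F$ has BLP if the congruence $f(F)$ has BLP; $R$ has BLP if all its congruences have BLP. FCLP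 and CBLP: for a congruence-distributive algebra $A$, $\mathrm{Con}(A)$ is its (distributive) bounded lattice of congruences, with bottom $\Delta_A$ (equality) and top $\nabla_A=A^2$; $\mathcal{B}(\mathrm{Con}(A))$ is the Boolean algebra of complemented elements of $\mathrm{Con}(A)$; $\mathrm{FC}(A)$ is the Boolean algebra of factor congruences, i.e. of those $\phi\in\mathrm{Con}(A)$ for which there is $\phi^*\in\mathrm{Con}(A)$ with $\phi\vee\phi^*=\nabla_A$, $\phi\cap\phi^*=\Delta_A$, $\phi\circ\phi^*=\phi^*\circ\phi$ ($\circ$ is relational composition). For $\theta\in\mathrm{Con}(A)$, the map $u_\theta:\mathrm{Con}(A)\to\mathrm{Con}(A/\theta)$, $u_\theta(\alpha)=(\alpha\vee\theta)/\theta=\{(a/\theta,b/\theta)\mid(a,b)\in\alpha\vee\theta\}$, is a bounded lattice morphism mapping $\mathrm{FC}(A)$ into $\mathrm{FC}(A/\theta)$ and $\mathcal{B}(\mathrm{Con}(A))$ into $\mathcal{B}(\mathrm{Con}(A/\theta))$. $\theta$ has FCLP if the restriction $\mathrm{FC}(A)\to\mathrm{FC}(A/\theta)$ of $u_\theta$ is surjective, and CBLP if the restriction $\mathcal{B}(\mathrm{Con}(A))\to\mathcal{B}(\mathrm{Con}(A/\theta))$ of $u_\theta$ is surjective. $A$ has FCLP (CBLP) if all its congruences do. *)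

(* Defs.v *)
From HB Require Import structures.
From mathcomp Require Import all_boot all_order.
From mathcomp Require Import generic_quotient.
From mathcomp Require Import all_classical.

Set Implicit Arguments.
Unset Strict Implicit.
Unset Printing Implicit Defensive.

Import Order.TTheory.
Local Open Scope order_scope.
Local Open Scope quotient_scope.

(* [\bot] and [\top] are the paper's 0 and 1; in particular the unit of the
   monoid is the top element. *)
HB.mixin Record isResiduated d R of Order.TBLattice d R := {
  rmul : R -> R -> R;
  rimp : R -> R -> R;
  rmulA : associative rmul;
  rmulC : commutative rmul;
  rmul1x : left_id (\top : R) rmul;
  rmul_adj : forall a b c : R, (rmul a b <= c) = (a <= rimp b c);
}.

#[short(type="resLatticeType")]
HB.structure Definition ResLattice d :=
  { R of Order.TBLattice d R & isResiduated d R }.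

Definition rbiimp d (R : resLatticeType d) (a b : R) : R :=
  rimp a b `&` rimp b a.

(* The carrier of the Boolean center [B(L)], e.g. for [L := R] and
   [L := Con(R)] below. *)
Definition complemented d (L : tbLatticeType d) : set L :=
  [set a : L | exists b : L, (a `|` b = \top /\ a `&` b = \bot)%O]%classic.

Section ResLatticeTheory.
Context d (R : resLatticeType d).
Implicit Types a b c : R.

Lemma rmulx1 a : rmul a \top = a.
Proof. by rewrite rmulC rmul1x. Qed.

Lemma rmul_impl a b : rmul (rimp a b) a <= b.
Proof. by rewrite rmul_adj. Qed.

Lemma rmul_le2 a a' b b' : a <= a' -> b <= b' -> rmul a b <= rmul a' b'.
Proof.
move=> aa' bb'; rewrite rmul_adj (le_trans aa')// -rmul_adj rmulC.
by rewrite rmul_adj (le_trans bb')// -rmul_adj rmulC.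
Qed.

Lemma rmul_lel a b : rmul a b <= a.
Proof. by rewrite -[leRHS]rmulx1 rmul_le2// lex1. Qed.

Lemma rmul_ler a b : rmul a b <= b.
Proof. by rewrite rmulC rmul_lel. Qed.

Lemma rimp_top a b : (rimp a b == \top) = (a <= b).
Proof. by rewrite -le1x -rmul_adj rmul1x. Qed.

Lemma rimpxx a : rimp a a = \top.
Proof. by apply/eqP; rewrite rimp_top. Qed.

Lemma rimp_trans a b c : rmul (rimp a b) (rimp b c) <= rimp a c.
Proof.
rewrite -rmul_adj (rmulC (rimp a b)) -rmulA.
by rewrite (le_trans _ (rmul_impl b c))// rmul_le2// rmul_impl.
Qed.

Lemma rbiimpC a b : rbiimp a b = rbiimp b a.
Proof. exact: meetC. Qed.

Lemma rbiimpxx a : rbiimp a a = \top.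
Proof. by rewrite /rbiimp rimpxx meetxx. Qed.

Lemma rbiimp_trans a b c : rmul (rbiimp a b) (rbiimp b c) <= rbiimp a c.
Proof.
rewrite lexI (le_trans _ (rimp_trans a b c)) ?rmul_le2 ?leIl//=.
by rewrite rmulC (le_trans _ (rimp_trans c b a))// rmul_le2 ?leIr.
Qed.

Lemma rimp_join a a' b b' :
  rmul (rimp a a') (rimp b b') <= rimp (a `|` b) (a' `|` b').
Proof.
rewrite -rmul_adj rmulC rmul_adj leUx -!rmul_adj.
rewrite rmulC (rmulC b); apply/andP; split.
- rewrite (le_trans _ (leUl a' b'))// (le_trans _ (rmul_impl a a'))//.
  by rewrite rmul_le2// rmul_lel.
- rewrite (le_trans _ (leUr b' a'))// (le_trans _ (rmul_impl b b'))//.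
  by rewrite rmul_le2// rmul_ler.
Qed.

Lemma rimp_meet a a' b b' :
  rmul (rimp a a') (rimp b b') <= rimp (a `&` b) (a' `&` b').
Proof.
rewrite -rmul_adj lexI; apply/andP; split.
- rewrite (le_trans _ (rmul_impl a a'))//.
  by rewrite rmul_le2 ?leIl// rmul_lel.
- rewrite (le_trans _ (rmul_impl b b'))//.
  by rewrite rmul_le2 ?leIr// rmul_ler.
Qed.

Lemma rimp_mul a a' b b' :
  rmul (rimp a a') (rimp b b') <= rimp (rmul a b) (rmul a' b').
Proof.
rewrite -rmul_adj rmulA -(rmulA _ _ a) (rmulC (rimp b b') a) rmulA.
by rewrite -rmulA rmul_le2// rmul_impl.
Qed.

Lemma rimp_imp a a' b b' :
  rmul (rimp a' a) (rimp b b') <= rimp (rimp a b) (rimp a' b').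
Proof.
rewrite -!rmul_adj (rmulC (rimp a' a)) -!rmulA (rmulA _ (rimp a b)).
rewrite (rmulC _ (rimp a b)) -rmulA (le_trans _ (rmul_impl b b'))// rmul_le2//.
by rewrite (le_trans _ (rmul_impl a b))// rmul_le2// rmul_impl.
Qed.

End ResLatticeTheory.

Definition compatible2 (T : Type) (op : T -> T -> T) (E : set (T * T)) :=
  forall x x' y y', E (x, x') -> E (y, y') -> E (op x y, op x' y').

Record con d (R : resLatticeType d) := Con {
  con_set :> set (R * R);
  con_refl : forall x, con_set (x, x);
  con_sym : forall x y, con_set (x, y) -> con_set (y, x);
  con_trans : forall y x z,
    con_set (x, y) -> con_set (y, z) -> con_set (x, z);
  con_join : compatible2 Order.join con_set;
  con_meet : compatible2 Order.meet con_set;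
  con_mul : compatible2 rmul con_set;
  con_imp : compatible2 rimp con_set;
}.

HB.instance Definition _ d (R : resLatticeType d) := gen_eqMixin (con R).
HB.instance Definition _ d (R : resLatticeType d) := gen_choiceMixin (con R).

Section ConLattice.
Context d (R : resLatticeType d).
Implicit Types phi psi chi : con R.

Lemma con_inj phi psi : con_set phi = con_set psi -> phi = psi.
Proof.
case: phi psi => [E ? ? ? ? ? ? ?] [E' ? ? ? ? ? ? ?] /= EE'.
by subst E'; congr Con; exact: Prop_irrelevance.
Qed.

Definition con_le phi psi : bool := `[< (phi `<=` psi)%classic >].

Lemma con_le_refl : reflexive con_le.
Proof. by move=> phi; apply/asboolP. Qed.

Lemma con_le_anti : antisymmetric con_le.
Proof.
move=> phi psi /andP[/asboolP le1 /asboolP le2].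
by apply: con_inj; apply/seteqP.
Qed.

Lemma con_le_trans : transitive con_le.
Proof.
move=> psi phi chi /asboolP le1 /asboolP le2.
by apply/asboolP; exact: subset_trans le1 le2.
Qed.

HB.instance Definition _ :=
  Order.Le_isPOrder.Build d (con R) con_le_refl con_le_anti con_le_trans.

Lemma con_leP phi psi : reflect (phi `<=` psi)%classic (phi <= psi).
Proof. exact: asboolP. Qed.

Definition con_cap phi psi : con R.
Proof.
refine (@Con d R (phi `&` psi)%classic _ _ _ _ _ _ _).
- by move=> x; split; exact: con_refl.
- by move=> x y [? ?]; split; exact: con_sym.
- by move=> y x z [? ?] [? ?]; split; exact: (@con_trans _ _ _ y).
- by move=> x x' y y' [? ?] [? ?]; split; exact: con_join.
- by move=> x x' y y' [? ?] [? ?]; split; exact: con_meet.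
- by move=> x x' y y' [? ?] [? ?]; split; exact: con_mul.
- by move=> x x' y y' [? ?] [? ?]; split; exact: con_imp.
Defined.

(* The least congruence containing [phi] and [psi]. *)
Definition con_sup phi psi : con R.
Proof.
refine (@Con d R [set p | forall chi : con R,
   (phi `<=` chi)%classic -> (psi `<=` chi)%classic -> con_set chi p]%classic
   _ _ _ _ _ _ _).
- by move=> x chi _ _; exact: con_refl.
- by move=> x y H chi h1 h2; apply: con_sym; exact: H.
- by move=> y x z H H' chi h1 h2;
    apply: (@con_trans _ _ _ y); [exact: H|exact: H'].
- by move=> x x' y y' H H' chi h1 h2; apply: con_join; [exact: H|exact: H'].
- by move=> x x' y y' H H' chi h1 h2; apply: con_meet; [exact: H|exact: H'].
- by move=> x x' y y' H H' chi h1 h2; apply: con_mul; [exact: H|exact: H'].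
- by move=> x x' y y' H H' chi h1 h2; apply: con_imp; [exact: H|exact: H'].
Defined.

Definition con_diag : con R.
Proof.
refine (@Con d R [set p | p.1 = p.2]%classic _ _ _ _ _ _ _) => //=.
- by move=> y x z -> ->.
all: by move=> x x' y y' /= -> ->.
Defined.

Definition con_full : con R.
Proof. by refine (@Con d R setT _ _ _ _ _ _ _). Defined.

Lemma con_capP phi psi chi :
  (phi <= con_cap psi chi) = (phi <= psi) && (phi <= chi).
Proof.
apply/con_leP/andP => [le|[/con_leP le1 /con_leP le2]].
- by split; apply/con_leP => p /le[].
- by move=> p phip; split; [exact: le1|exact: le2].
Qed.

Lemma con_supP phi psi chi :
  (con_sup phi psi <= chi) = (phi <= chi) && (psi <= chi).
Proof.
apply/con_leP/andP => [le|[/con_leP le1 /con_leP le2]].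
- split; apply/con_leP => p pp; apply: le => /= xi h1 h2.
  + exact: h1.
  + exact: h2.
- by move=> p /(_ chi le1 le2).
Qed.

Lemma con_diagP phi : con_diag <= phi.
Proof. by apply/con_leP => -[x y] /= ->; exact: con_refl. Qed.

Lemma con_fullP phi : phi <= con_full.
Proof. exact/con_leP. Qed.

HB.instance Definition _ :=
  Order.POrder_isMeetSemilattice.Build d (con R) con_capP.
HB.instance Definition _ :=
  Order.POrder_isJoinSemilattice.Build d (con R) con_supP.
HB.instance Definition _ := Order.hasBottom.Build d (con R) con_diagP.
HB.instance Definition _ := Order.hasTop.Build d (con R) con_fullP.

End ConLattice.

Section Quotient.
Context d (R : resLatticeType d) (phi : con R).

Definition con_rel : rel R := fun x y => `[< con_set phi (x, y) >].

Lemma con_rel_refl : reflexive con_rel.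
Proof. by move=> x; apply/asboolP/con_refl. Qed.

Lemma con_rel_sym : symmetric con_rel.
Proof. by move=> x y; apply/asboolP/asboolP; exact: con_sym. Qed.

Lemma con_rel_trans : transitive con_rel.
Proof.
by move=> y x z /asboolP xy /asboolP yz; apply/asboolP/(con_trans xy yz).
Qed.

Definition con_equiv : equiv_rel R :=
  EquivRel con_rel con_rel_refl con_rel_sym con_rel_trans.

Definition quot : Type := {eq_quot con_equiv}.
HB.instance Definition _ := EqQuotient.on quot.
HB.instance Definition _ := Choice.on quot.

Definition quot_pi (x : R) : quot := \pi_quot x.

Lemma quot_piP x y : quot_pi x = quot_pi y <-> con_set phi (x, y).
Proof.
rewrite /quot_pi; split; first by move=> /eqmodP /asboolP.
by move=> xy; apply/eqmodP/asboolP.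
Qed.

Lemma quot_ind (P : quot -> Prop) : (forall x, P (quot_pi x)) -> forall q, P q.
Proof. by move=> Ppi q; rewrite -[q]reprK; exact: Ppi. Qed.

Definition quot_op (op : R -> R -> R) (p q : quot) : quot :=
  quot_pi (op (repr p) (repr q)).

Lemma quot_opE op : compatible2 op phi ->
  forall x y, quot_op op (quot_pi x) (quot_pi y) = quot_pi (op x y).
Proof.
by move=> cop x y; apply/quot_piP; apply: cop; apply/quot_piP; exact: reprK.
Qed.

Definition qjoin := quot_op Order.join.
Definition qmeet := quot_op Order.meet.
Definition qmul := quot_op rmul.
Definition qimp := quot_op rimp.

Let qE := (quot_opE (@con_join _ _ phi), quot_opE (@con_meet _ _ phi),
  quot_opE (@con_mul _ _ phi), quot_opE (@con_imp _ _ phi)).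

Definition quot_le (p q : quot) := qmeet p q == p.

Lemma quot_le_refl : reflexive quot_le.
Proof.
by move=> p; elim/quot_ind: p => x; rewrite /quot_le /qmeet qE meetxx.
Qed.

Lemma qmeetC : commutative qmeet.
Proof.
move=> p q; elim/quot_ind: p => x; elim/quot_ind: q => y.
by rewrite /qmeet !qE meetC.
Qed.

Lemma qjoinC : commutative qjoin.
Proof.
move=> p q; elim/quot_ind: p => x; elim/quot_ind: q => y.
by rewrite /qjoin !qE joinC.
Qed.

Lemma qmeetA : associative qmeet.
Proof.
move=> p q r; elim/quot_ind: p => x; elim/quot_ind: q => y.
by elim/quot_ind: r => z; rewrite /qmeet !qE meetA.
Qed.

Lemma qjoinA : associative qjoin.
Proof.
move=> p q r; elim/quot_ind: p => x; elim/quot_ind: q => y.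
by elim/quot_ind: r => z; rewrite /qjoin !qE joinA.
Qed.

Lemma qjoinKI p q : qmeet q (qjoin q p) = q.
Proof.
elim/quot_ind: p => x; elim/quot_ind: q => y.
by rewrite /qmeet /qjoin !qE joinKI.
Qed.

Lemma qmeetKU p q : qjoin q (qmeet q p) = q.
Proof.
elim/quot_ind: p => x; elim/quot_ind: q => y.
by rewrite /qmeet /qjoin !qE meetKU.
Qed.

Lemma quot_le_anti : antisymmetric quot_le.
Proof. by move=> p q /andP[/eqP pq /eqP qp]; rewrite -pq qmeetC qp. Qed.

Lemma quot_le_trans : transitive quot_le.
Proof.
move=> q p r /eqP pq /eqP qr.
by rewrite /quot_le -pq -qmeetA qr.
Qed.

HB.instance Definition _ :=
  Order.Le_isPOrder.Build d quot quot_le_refl quot_le_anti quot_le_trans.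

Lemma quot_leEmeet (p q : quot) : (p <= q) = (qmeet p q == p).
Proof. by []. Qed.

HB.instance Definition _ := Order.POrder_isLattice.Build d quot
  qmeetC qjoinC qmeetA qjoinA qjoinKI qmeetKU quot_leEmeet.

Lemma quot_le0x (p : quot) : quot_pi \bot <= p.
Proof.
by elim/quot_ind: p => x; rewrite quot_leEmeet /qmeet qE meet0x.
Qed.

Lemma quot_lex1 (p : quot) : p <= quot_pi \top.
Proof.
by elim/quot_ind: p => x; rewrite quot_leEmeet /qmeet qE meetx1.
Qed.

HB.instance Definition _ := Order.hasBottom.Build d quot quot_le0x.
HB.instance Definition _ := Order.hasTop.Build d quot quot_lex1.

Lemma qmulA : associative qmul.
Proof.
move=> p q r; elim/quot_ind: p => x; elim/quot_ind: q => y.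
by elim/quot_ind: r => z; rewrite /qmul !qE rmulA.
Qed.

Lemma qmulC : commutative qmul.
Proof.
move=> p q; elim/quot_ind: p => x; elim/quot_ind: q => y.
by rewrite /qmul !qE rmulC.
Qed.

Lemma qmul1x : left_id (\top : quot) qmul.
Proof.
by elim/quot_ind => x; rewrite /qmul [X in quot_op _ X]/(quot_pi \top) qE rmul1x.
Qed.

Lemma quot_pi_le x y : x <= y -> quot_pi x <= quot_pi y.
Proof. by rewrite quot_leEmeet /qmeet qE => /meet_idPl ->. Qed.

Lemma quot_le_meet x y : quot_pi x <= quot_pi y ->
  quot_pi (x `&` y) = quot_pi x.
Proof. by rewrite quot_leEmeet /qmeet qE => /eqP. Qed.

Lemma qmul_adj (p q r : quot) : (qmul p q <= r) = (p <= qimp q r).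
Proof.
elim/quot_ind: p => x; elim/quot_ind: q => y; elim/quot_ind: r => z.
rewrite /qmul /qimp !qE; apply/idP/idP => /quot_le_meet h.
- have -> : quot_pi (rimp y z) = quot_pi (rimp y (rmul x y `|` z)).
    apply/quot_piP/con_imp; first exact: con_refl.
    rewrite -{1}(join_idPr (leIr z (rmul x y))).
    by apply: con_join; [exact/quot_piP|exact: con_refl].
  by apply: quot_pi_le; rewrite -rmul_adj leUl.
- have -> : quot_pi (rmul x y) = quot_pi (rmul (x `&` rimp y z) y).
    apply/quot_piP/con_mul; last exact: con_refl.
    exact/con_sym/quot_piP.
  by apply: quot_pi_le; rewrite rmul_adj leIr.
Qed.

HB.instance Definition _ :=
  isResiduated.Build d quot qmulA qmulC qmul1x qmul_adj.

Lemma quot_pi_join x y : quot_pi (x `|` y) = quot_pi x `|` quot_pi y.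
Proof. exact/esym/(quot_opE (@con_join _ _ phi)). Qed.

Lemma quot_pi_meet x y : quot_pi (x `&` y) = quot_pi x `&` quot_pi y.
Proof. exact/esym/(quot_opE (@con_meet _ _ phi)). Qed.

Lemma quot_pi_mul x y : quot_pi (rmul x y) = rmul (quot_pi x) (quot_pi y).
Proof. exact/esym/(quot_opE (@con_mul _ _ phi)). Qed.

Lemma quot_pi_imp x y : quot_pi (rimp x y) = rimp (quot_pi x) (quot_pi y).
Proof. exact/esym/(quot_opE (@con_imp _ _ phi)). Qed.

End Quotient.

Section QuotCon.
Context d (R : resLatticeType d) (theta : con R).

Definition quot_con_set (beta : con R) : set (quot theta * quot theta) :=
  [set (quot_pi theta x.1, quot_pi theta x.2) | x in con_set beta]%classic.

Lemma quot_con_setE beta x y : theta <= beta ->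
  quot_con_set beta (quot_pi theta x, quot_pi theta y) <-> con_set beta (x, y).
Proof.
move=> /con_leP le; split=> [[[a b]] /= ab [/quot_piP ax /quot_piP by_]|xy].
- apply: (con_trans (y := a)); first exact/con_sym/le.
  by apply: (con_trans ab); exact: le.
- by exists (x, y).
Qed.

Definition quot_con (beta : con R) (le : theta <= beta) : con (quot theta).
Proof.
refine (@Con d _ (quot_con_set beta) _ _ _ _ _ _ _).
- by elim/quot_ind => x; apply/quot_con_setE => //; exact: con_refl.
- move=> p q; elim/quot_ind: p => x; elim/quot_ind: q => y.
  by move=> /(quot_con_setE _ _ le) h; apply/quot_con_setE/con_sym.
- move=> q p r; elim/quot_ind: p => x; elim/quot_ind: q => y.
  elim/quot_ind: r => z.
  move=> /(quot_con_setE _ _ le) h /(quot_con_setE _ _ le) h'.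
  exact/quot_con_setE/(con_trans h h').
- elim/quot_ind => x; elim/quot_ind => x'.
  elim/quot_ind => y; elim/quot_ind => y'.
  move=> /(quot_con_setE _ _ le) h /(quot_con_setE _ _ le) h'.
  by rewrite -!quot_pi_join; exact/quot_con_setE/con_join.
- elim/quot_ind => x; elim/quot_ind => x'.
  elim/quot_ind => y; elim/quot_ind => y'.
  move=> /(quot_con_setE _ _ le) h /(quot_con_setE _ _ le) h'.
  by rewrite -!quot_pi_meet; exact/quot_con_setE/con_meet.
- elim/quot_ind => x; elim/quot_ind => x'.
  elim/quot_ind => y; elim/quot_ind => y'.
  move=> /(quot_con_setE _ _ le) h /(quot_con_setE _ _ le) h'.
  by rewrite -!quot_pi_mul; exact/quot_con_setE/con_mul.
- elim/quot_ind => x; elim/quot_ind => x'.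
  elim/quot_ind => y; elim/quot_ind => y'.
  move=> /(quot_con_setE _ _ le) h /(quot_con_setE _ _ le) h'.
  by rewrite -!quot_pi_imp; exact/quot_con_setE/con_imp.
Defined.

(* [u_theta alpha = (alpha `|` theta) / theta], the last slash being the quotient. *)
Definition u_con (alpha : con R) : con (quot theta) :=
  quot_con (leUr theta alpha).

End QuotCon.

Definition factor_con d (R : resLatticeType d) : set (con R) :=
  [set phi : con R | exists phi' : con R,
    [/\ (phi `|` phi' = \top)%O, (phi `&` phi' = \bot)%O &
        (con_set phi \; con_set phi' = con_set phi' \; con_set phi)%relation]
  ]%classic.

Section LiftingProperties.
Context d (R : resLatticeType d).

Definition BLP_con (phi : con R) :=
  set_surj (@complemented _ R) (@complemented _ (quot phi)) (quot_pi phi).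

Definition CBLP_con (theta : con R) :=
  set_surj (@complemented _ (con R)) (@complemented _ (con (quot theta)))
    (u_con theta).

Definition FCLP_con (theta : con R) :=
  set_surj (@factor_con _ R) (@factor_con _ (quot theta)) (u_con theta).

End LiftingProperties.

Definition BLP d (R : resLatticeType d) := forall phi : con R, BLP_con phi.
Definition CBLP d (R : resLatticeType d) := forall phi : con R, CBLP_con phi.
Definition FCLP d (R : resLatticeType d) := forall phi : con R, FCLP_con phi.

Record filt d (R : resLatticeType d) := Filt {
  filt_set :> set R;
  filt_nonempty : (filt_set !=set0)%classic;
  filt_mul : forall x y, filt_set x -> filt_set y -> filt_set (rmul x y);
  filt_up : forall x y, filt_set x -> x <= y -> filt_set y;
}.

HB.instance Definition _ d (R : resLatticeType d) := gen_eqMixin (filt R).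
HB.instance Definition _ d (R : resLatticeType d) := gen_choiceMixin (filt R).

Section FiltLattice.
Context d (R : resLatticeType d).
Implicit Types F G H : filt R.

Lemma filt_inj F G : filt_set F = filt_set G -> F = G.
Proof.
case: F G => [E ? ? ?] [E' ? ? ?] /= EE'.
by subst E'; congr Filt; exact: Prop_irrelevance.
Qed.

Lemma filt_top F : filt_set F \top.
Proof. by have [x Fx] := filt_nonempty F; apply: (filt_up Fx); exact: lex1. Qed.

Definition filt_le F G : bool := `[< (F `<=` G)%classic >].

Lemma filt_le_refl : reflexive filt_le.
Proof. by move=> F; apply/asboolP. Qed.

Lemma filt_le_anti : antisymmetric filt_le.
Proof.
move=> F G /andP[/asboolP le1 /asboolP le2].
by apply: filt_inj; apply/seteqP.
Qed.

Lemma filt_le_trans : transitive filt_le.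
Proof.
move=> F G H /asboolP le1 /asboolP le2.
by apply/asboolP; exact: subset_trans le1 le2.
Qed.

HB.instance Definition _ :=
  Order.Le_isPOrder.Build d (filt R) filt_le_refl filt_le_anti filt_le_trans.

Lemma filt_leP F G : reflect (F `<=` G)%classic (F <= G).
Proof. exact: asboolP. Qed.

Definition filt_cap F G : filt R.
Proof.
refine (@Filt d R (F `&` G)%classic _ _ _).
- by exists \top; split; exact: filt_top.
- by move=> x y [? ?] [? ?]; split; exact: filt_mul.
- by move=> x y [Fx Gx] xy; split; [exact: filt_up xy|exact: filt_up xy].
Defined.

(* The least filter containing [F] and [G]. *)
Definition filt_sup F G : filt R.
Proof.
refine (@Filt d R [set x | forall H : filt R,
   (F `<=` H)%classic -> (G `<=` H)%classic -> filt_set H x]%classic _ _ _).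
- by exists \top => H _ _; exact: filt_top.
- by move=> x y Hx Hy H h1 h2; apply: filt_mul; [exact: Hx|exact: Hy].
- by move=> x y Hx xy H h1 h2; apply: (filt_up _ xy); exact: Hx.
Defined.

Definition filt_one : filt R.
Proof.
refine (@Filt d R [set \top]%classic _ _ _).
- by exists \top.
- by move=> x y /= -> ->; rewrite rmulx1.
- by move=> x y /= ->; rewrite le1x => /eqP.
Defined.

Definition filt_full : filt R.
Proof. by refine (@Filt d R setT _ _ _) => //; exists \top. Defined.

Lemma filt_capP F G H : (F <= filt_cap G H) = (F <= G) && (F <= H).
Proof.
apply/filt_leP/andP => [le|[/filt_leP le1 /filt_leP le2]].
- by split; apply/filt_leP => p /le[].
- by move=> p Fp; split; [exact: le1|exact: le2].
Qed.

Lemma filt_supP F G H : (filt_sup F G <= H) = (F <= H) && (G <= H).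
Proof.
apply/filt_leP/andP => [le|[/filt_leP le1 /filt_leP le2]].
- by split; apply/filt_leP => p pp; apply: le => /= K h1 h2; auto.
- by move=> p /(_ H le1 le2).
Qed.

Lemma filt_oneP F : filt_one <= F.
Proof. by apply/filt_leP => x /= ->; exact: filt_top. Qed.

Lemma filt_fullP F : F <= filt_full.
Proof. exact/filt_leP. Qed.

HB.instance Definition _ :=
  Order.POrder_isMeetSemilattice.Build d (filt R) filt_capP.
HB.instance Definition _ :=
  Order.POrder_isJoinSemilattice.Build d (filt R) filt_supP.
HB.instance Definition _ := Order.hasBottom.Build d (filt R) filt_oneP.
HB.instance Definition _ := Order.hasTop.Build d (filt R) filt_fullP.

End FiltLattice.

Section FiltCon.
Context d (R : resLatticeType d).
Implicit Types (F G : filt R) (phi : con R).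

Lemma filt_compat F (op : R -> R -> R) :
    (forall x x' y y', rmul (rbiimp x x') (rbiimp y y') <=
       rimp (op x y) (op x' y')) ->
  compatible2 op [set p | filt_set F (rbiimp p.1 p.2)]%classic.
Proof.
move=> h x x' y y' /= Fx Fy; apply: filt_up (filt_mul Fx Fy) _.
by rewrite lexI h rbiimpC (rbiimpC y) h.
Qed.

(* The map [f]; [filt_con_bij] to [filt_con1] below: it is a lattice isomorphism. *)
Definition filt_con F : con R.
Proof.
refine (@Con d R [set p | filt_set F (rbiimp p.1 p.2)]%classic _ _ _ _ _ _ _).
- by move=> x /=; rewrite rbiimpxx; exact: filt_top.
- by move=> x y /=; rewrite rbiimpC.
- move=> y x z /= Fx Fy; apply: filt_up (filt_mul Fx Fy) _.
  exact: rbiimp_trans.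
- apply: filt_compat => x x' y y'; apply: le_trans (rimp_join _ _ _ _).
  by rewrite rmul_le2 ?leIl.
- apply: filt_compat => x x' y y'; apply: le_trans (rimp_meet _ _ _ _).
  by rewrite rmul_le2 ?leIl.
- apply: filt_compat => x x' y y'; apply: le_trans (rimp_mul _ _ _ _).
  by rewrite rmul_le2 ?leIl.
- apply: filt_compat => x x' y y'; apply: le_trans (rimp_imp _ _ _ _).
  by rewrite rmul_le2 ?leIl ?leIr.
Defined.

Definition con_filt phi : filt R.
Proof.
refine (@Filt d R [set x | con_set phi (x, \top)]%classic _ _ _).
- by exists \top; exact: con_refl.
- move=> x y /= hx hy; rewrite -[\top]rmul1x; exact: con_mul.
- move=> x y /= hx xy; have := con_join hx (con_refl phi y).
  by rewrite (join_idPr xy) join1x.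
Defined.

Lemma filt_conK : cancel filt_con con_filt.
Proof.
move=> F; apply: filt_inj; apply/seteqP; split=> x /=.
- move=> h; apply: (filt_up h); rewrite (le_trans (leIr _ _))//.
  by have := rmul_impl (\top : R) x; rewrite rmulx1.
- by move=> Fx; apply: (filt_up Fx); rewrite lexI -!rmul_adj lex1 rmulx1 lexx.
Qed.

Lemma con_filtK : cancel con_filt filt_con.
Proof.
move=> phi; apply: con_inj; apply/seteqP; split=> -[x y] /= h; last first.
  rewrite -(meetxx \top) -{1}(rimpxx y) -{1}(rimpxx y).
  by apply: con_meet; apply: con_imp => //; exact: con_refl.
have hxy : con_set phi (rimp x y, \top).
  exact: (@filt_up _ _ (con_filt phi) (rbiimp x y) _ h (leIl _ _)).
have hyx : con_set phi (rimp y x, \top).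
  exact: (@filt_up _ _ (con_filt phi) (rbiimp x y) _ h (leIr _ _)).
have step a b : con_set phi (rimp a b, \top) -> con_set phi (a `|` b, b).
  move=> hab; have h1 : con_set phi (rmul (rimp a b) a, a).
    rewrite -[X in con_set phi (_, X)]rmul1x.
    by apply: con_mul => //; exact: con_refl.
  rewrite -{2}(join_idPr (rmul_impl a b)).
  by apply: con_join; [exact: con_sym|exact: con_refl].
apply: con_trans (step _ _ hxy).
by apply: con_sym; rewrite joinC; exact: step.
Qed.

Lemma filt_con_bij : bijective filt_con.
Proof. exists con_filt; [exact: filt_conK|exact: con_filtK]. Qed.

Lemma filt_con_le F G : (filt_con F <= filt_con G) = (F <= G).
Proof.
apply/con_leP/filt_leP => le; last by move=> p /=; exact: le.
have FK := filt_conK F; have GK := filt_conK G.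
move=> x Fx; rewrite -GK; apply: (le (x, \top)).
by rewrite -FK in Fx.
Qed.

Lemma filt_conI F G : filt_con (F `&` G) = filt_con F `&` filt_con G.
Proof.
apply/le_anti/andP; split; first by rewrite lexI !filt_con_le leIl leIr.
rewrite -[leLHS]con_filtK filt_con_le lexI -!filt_con_le con_filtK.
by rewrite leIl leIr.
Qed.

Lemma filt_conU F G : filt_con (F `|` G) = filt_con F `|` filt_con G.
Proof.
apply/le_anti/andP; split; last by rewrite leUx !filt_con_le leUl leUr.
rewrite -[leRHS]con_filtK filt_con_le leUx -!filt_con_le con_filtK.
by rewrite leUl leUr.
Qed.

Lemma filt_con0 : filt_con \bot = \bot.
Proof.
by apply/le_anti; rewrite le0x -[leRHS]con_filtK filt_con_le le0x.
Qed.

Lemma filt_con1 : filt_con \top = \top.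
Proof.
by apply/le_anti; rewrite lex1 -[leLHS]con_filtK filt_con_le lex1.
Qed.

Definition BLP_filt F := BLP_con (filt_con F).

End FiltCon.

(* Main.v *)
Require Import Defs.
From mathcomp Require Import all_boot all_order.
From mathcomp Require Import all_classical.

(** The complemented congruences, the factor congruences and the principal
    congruences [Cg(e, 1)] with [e] in the Boolean center are the same thing.
    Indeed, if the filters [F] and [G] are complements of each other, then
    [f * g = 0] for some [f] in [F] and [g] in [G], while [f \/ g] lies in
    [F /\ G = {1}]; this forces [f] and [g] to be complementary and
    [F = {x | f <= x}].  Moreover [(e /\ x) \/ (e' /\ z)] links [x] to [z]
    through [Cg(e, 1)] and [Cg(e', 1)], in either order, so these two
    congruences permute.  Hence [e |-> Cg(e, 1)] is a bijection from the
    Boolean center onto the complemented congruences, and it commutes with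
    taking quotients. *)

Set Implicit Arguments.
Unset Strict Implicit.
Unset Printing Implicit Defensive.

Import Order.TTheory.
Local Open Scope order_scope.

Section Residuated.
Context d (R : resLatticeType d).
Implicit Types (a b c e x y z : R) (F G : filt R) (phi psi : con R).

Lemma rmul_join_le a b c z :
  (rmul (a `|` b) c <= z) = (rmul a c <= z) && (rmul b c <= z).
Proof. by rewrite rmul_adj leUx -!rmul_adj. Qed.

(** Multiply the meet by [a \/ b = 1] and distribute: both terms lie below [rmul a b]. *)
Lemma rmul_eq0_meet a b :
  a `|` b = \top -> rmul a b = \bot -> a `&` b = \bot.
Proof.
move=> ab1 ab0; apply/eqP; rewrite -lex0 -[leLHS]rmul1x -ab1 rmul_join_le -ab0.
by rewrite [X in _ && (_ <= X)]rmulC !rmul_le2// ?leIr ?leIl.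
Qed.

(** Distribute [e = (e \/ e') * e]; the term [e' * e] vanishes, being below [e /\ e' = 0]. *)
Lemma complemented_idem e : complemented e -> rmul e e = e.
Proof.
move=> [e' [ee'1 ee'0]]; apply/le_anti; rewrite rmul_lel /=.
rewrite -{1}[e]rmul1x -ee'1 rmul_join_le lexx /=.
apply: (le_trans _ (le0x _)).
by rewrite -ee'0 lexI rmul_ler rmul_lel.
Qed.

Definition up_filt e (ee : rmul e e = e) : filt R.
Proof.
refine (@Filt d R [set x | e <= x]%classic _ _ _).
- by exists e => /=.
- by move=> x y /= ex ey; rewrite -ee rmul_le2.
- by move=> x y /=; exact: le_trans.
Defined.

Lemma filt_con_topE F x : con_set (filt_con F) (x, \top) <-> filt_set F x.
Proof. by rewrite -[in X in _ <-> X](filt_conK F). Qed.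

Lemma con_le_mem phi psi p : phi <= psi -> con_set phi p -> con_set psi p.
Proof. by move=> /con_leP; apply. Qed.

(** Through [filt_con], inclusions of congruences reduce to inclusions of the classes of 1. *)
Lemma con_le_topP phi psi :
  phi <= psi <-> forall x, con_set phi (x, \top) -> con_set psi (x, \top).
Proof.
rewrite -{1}(con_filtK phi) -{1}(con_filtK psi) filt_con_le.
by split=> [/filt_leP|le]; [|apply/filt_leP].
Qed.

Definition filt_gen a : filt R.
Proof.
refine (@Filt d R
  [set x | forall F, filt_set F a -> filt_set F x]%classic _ _ _).
- by exists a => /=.
- by move=> x y Hx Hy F Fa; apply: filt_mul; [exact: Hx|exact: Hy].
- by move=> x y Hx xy F Fa; apply: (filt_up _ xy); exact: Hx.
Defined.

(** This is [Cg(a, 1)]; [princ_conP] is its universal property. *)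
Definition princ_con a : con R := filt_con (filt_gen a).

Lemma princ_conP a phi : princ_con a <= phi <-> con_set phi (a, \top).
Proof.
split=> [/con_le_topP|phia]; first by apply; apply/filt_con_topE.
by apply/con_le_topP => x /filt_con_topE /(_ (con_filt phi)); apply.
Qed.

Lemma princ_con_self a : con_set (princ_con a) (a, \top).
Proof. exact/princ_conP. Qed.
Arguments princ_con_self a : clear implicits.

(** As [e] is idempotent, its up-set is already a filter, hence the one generated by [e]. *)
Lemma princ_con_topE e x :
  complemented e -> con_set (princ_con e) (x, \top) <-> e <= x.
Proof.
move=> /complemented_idem ee; split=> [/filt_con_topE|ex].
  by move=> /(_ (up_filt ee)) /=; apply.
by apply/filt_con_topE => F Fe; exact: filt_up Fe ex.
Qed.

Lemma princ_con_inj a b :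
  complemented a -> complemented b -> princ_con a = princ_con b -> a = b.
Proof.
move=> ca cb ab; apply/le_anti/andP; split.
- by apply/princ_con_topE => //; rewrite ab; exact: princ_con_self.
- by apply/princ_con_topE => //; rewrite -ab; exact: princ_con_self.
Qed.

Lemma con_bot_top phi : con_set phi (\bot, \top) -> phi = \top.
Proof.
move=> phi0; apply/le_anti; rewrite lex1 /=.
apply/con_le_topP => x _.
by have := con_join phi0 (con_refl phi x); rewrite join0x join1x.
Qed.

(** The elements above some product [f * g] form a filter containing [F] and [G], hence their join,
    and so 0. *)
Lemma filt_sup_botP F G :
  F `|` G = \top -> exists f g, [/\ filt_set F f, filt_set G g & rmul f g = \bot].
Proof.
move=> FG1.
pose S := [set x | exists f g,
  [/\ filt_set F f, filt_set G g & rmul f g <= x]]%classic.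
have Sn0 : (S !=set0)%classic.
  by exists \top, \top, \top; split; rewrite ?lex1//; exact: filt_top.
have Smul x y : S x -> S y -> S (rmul x y).
  move=> [f [g [Ff Gg fgx]]] [f' [g' [Ff' Gg' fgy]]].
  exists (rmul f f'), (rmul g g'); split; [exact: filt_mul|exact: filt_mul|].
  rewrite -rmulA (rmulA f') (rmulC f') -rmulA rmulA.
  exact: rmul_le2.
have Sup x y : S x -> x <= y -> S y.
  by move=> [f [g [Ff Gg fgx]]] xy; exists f, g; split=> //; exact: le_trans xy.
have : F `|` G <= Filt Sn0 Smul Sup.
  rewrite leUx; apply/andP; split; apply/filt_leP => x ? /=.
  - by exists x, \top; split=> //; [exact: filt_top|rewrite rmulx1].
  - by exists \top, x; split=> //; [exact: filt_top|rewrite rmul1x].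
rewrite FG1 => /filt_leP /(_ \bot I) [f [g [Ff Gg fg0]]].
by exists f, g; split=> //; apply/eqP; rewrite -lex0.
Qed.

Lemma complemented_con_princ phi :
  complemented phi -> exists2 e : R, complemented e & phi = princ_con e.
Proof.
move=> [psi [phipsi1 phipsi0]].
have [|f [g [Ff Gg fg0]]] := @filt_sup_botP (con_filt phi) (con_filt psi).
  by apply: (bij_inj (filt_con_bij R)); rewrite filt_conU !con_filtK filt_con1.
(* [x \/ y] lies above [x] and [y], so it is in both filters, which meet in {1}. *)
have cap1 x y : con_set phi (x, \top) -> con_set psi (y, \top) ->
    x `|` y = \top.
  move=> phix psiy.
  have : con_set (phi `&` psi) (x `|` y, \top).
    split; first exact: (@filt_up _ _ (con_filt phi) x _ phix (leUl _ _)).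
    exact: (@filt_up _ _ (con_filt psi) y _ psiy (leUr _ _)).
  by rewrite phipsi0.
have fg1 := cap1 _ _ Ff Gg.
have cf : complemented f by exists g; split=> //; exact: rmul_eq0_meet.
exists f => //; apply/le_anti/andP; split; last exact/princ_conP.
apply/con_le_topP => x phix; apply/princ_con_topE => //.
(* Since [x \/ g = 1] and [g * f = 0], [f = (x \/ g) * f] lies below [x]. *)
rewrite -[f]rmul1x -(cap1 _ _ phix Gg) rmul_join_le rmul_lel /=.
by rewrite rmulC fg0 le0x.
Qed.

(** Modulo [Cg(a, 1)], [a] becomes 1 and [b = 1 /\ b] becomes [a /\ b = 0]. *)
Lemma princ_con_mix a b x z : a `&` b = \bot ->
  con_set (princ_con a) ((a `&` x) `|` (b `&` z), x).
Proof.
move=> ab0; have a1 := princ_con_self a.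
have b0 : con_set (princ_con a) (b, \bot).
  have := con_meet (con_sym a1) (con_refl (princ_con a) b).
  by rewrite meet1x ab0.
have := con_join (con_meet a1 (con_refl (princ_con a) x))
                 (con_meet b0 (con_refl (princ_con a) z)).
by rewrite meet1x meet0x joinx0.
Qed.

(** The composite is the full relation in either order, whence permutability. *)
Lemma princ_con_comp e e' x z : e `&` e' = \bot ->
  (con_set (princ_con e) \; con_set (princ_con e'))%relation (x, z).
Proof.
move=> ee'0; exists ((e' `&` x) `|` (e `&` z)).
- by apply/con_sym/princ_con_mix; rewrite meetC.
- by rewrite joinC; exact: princ_con_mix.
Qed.

Lemma factor_con_princ e : complemented e -> factor_con (princ_con e).
Proof.
move=> ce; have [e' [ee'1 ee'0]] := ce.
have ce' : complemented e' by exists e; rewrite joinC meetC.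
exists (princ_con e'); split.
(* The join contains [(e, 1)] and [(e', 1)], hence their meet [(0, 1)]. *)
- apply: con_bot_top; rewrite -ee'0 -[\top]meetxx; apply: con_meet.
  + exact: con_le_mem (leUl _ _) (princ_con_self e).
  + exact: con_le_mem (leUr _ _) (princ_con_self e').
- apply/le_anti; rewrite le0x andbT.
  apply/con_le_topP => x [/princ_con_topE ex /princ_con_topE e'x].
  by apply/eqP; rewrite -le1x -ee'1 leUx ex// e'x.
- apply/seteqP; split=> -[x z] _; apply: princ_con_comp => //.
  by rewrite meetC.
Qed.

Lemma factor_conE : @factor_con _ R = @complemented _ (con R).
Proof.
apply/seteqP; split=> phi; first by move=> [psi [? ? _]]; exists psi.
by move=> /complemented_con_princ [e ce ->]; exact: factor_con_princ.
Qed.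

Lemma complemented_princ_con e :
  complemented e -> complemented (princ_con e).
Proof. by move=> /factor_con_princ; rewrite factor_conE. Qed.

End Residuated.
Arguments princ_con_self {d R} a.

Section Quotient.
Context d (R : resLatticeType d) (theta : con R).

Definition con_preim (beta : con (quot theta)) : con R.
Proof.
refine (@Con d R
  [set p | con_set beta (quot_pi theta p.1, quot_pi theta p.2)]%classic
  _ _ _ _ _ _ _) => /=.
- by move=> x; exact: con_refl.
- by move=> x y; exact: con_sym.
- by move=> y x z; exact: con_trans.
- by move=> x x' y y' /= ? ?; rewrite !quot_pi_join; exact: con_join.
- by move=> x x' y y' /= ? ?; rewrite !quot_pi_meet; exact: con_meet.
- by move=> x x' y y' /= ? ?; rewrite !quot_pi_mul; exact: con_mul.
- by move=> x x' y y' /= ? ?; rewrite !quot_pi_imp; exact: con_imp.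
Defined.

Lemma con_preim_ge beta : theta <= con_preim beta.
Proof. by apply/con_leP => -[x y] /quot_piP /= ->; exact: con_refl. Qed.

(** For the inclusion from left to right, the preimage of the right-hand side contains both [theta]
    and [(a, 1)], hence the join defining [u_con]. *)
Lemma u_con_princ (a : R) :
  u_con theta (princ_con a) = princ_con (quot_pi theta a).
Proof.
apply/le_anti/andP; split; last first.
  apply/princ_conP; apply/(quot_con_setE a \top (leUr theta (princ_con a))).
  exact: con_le_mem (leUl _ _) (princ_con_self a).
have le : princ_con a `|` theta <= con_preim (princ_con (quot_pi theta a)).
  rewrite leUx; apply/andP; split; first exact/princ_conP/princ_con_self.
  exact: con_preim_ge.
by apply/con_leP => _ [[x y] /= xy <-]; exact: con_le_mem le xy.
Qed.

Lemma complemented_quot_pi (e : R) :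
  complemented e -> complemented (quot_pi theta e).
Proof.
move=> [e' [ee'1 ee'0]]; exists (quot_pi theta e').
by rewrite -quot_pi_join -quot_pi_meet ee'1 ee'0.
Qed.

Lemma BLP_CBLP_con : BLP_con theta <-> CBLP_con theta.
Proof.
split=> surj.
- move=> _ /complemented_con_princ[q /surj[e ce <-] ->].
  by exists (princ_con e); [exact: complemented_princ_con|exact: u_con_princ].
- move=> q cq; have [_ /complemented_con_princ[e ce ->]] :=
    surj _ (complemented_princ_con cq).
  (* Injectivity of [princ_con] in the quotient turns equal congruences into [e / theta = q]. *)
  rewrite u_con_princ => /princ_con_inj eq; exists e => //.
  by apply: eq => //; exact: complemented_quot_pi.
Qed.

Lemma CBLP_FCLP_con : CBLP_con theta <-> FCLP_con theta.
Proof. by rewrite /FCLP_con !factor_conE. Qed.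

End Quotient.

Theorem proposition4p2 (d : Order.disp_t) (R : resLatticeType d) :
  (forall F : filt R,
     (BLP_filt F <-> BLP_con (filt_con F)) /\
     (BLP_con (filt_con F) <-> CBLP_con (filt_con F)) /\
     (CBLP_con (filt_con F) <-> FCLP_con (filt_con F))) /\
  (forall phi : con R,
     (BLP_con phi <-> CBLP_con phi) /\ (CBLP_con phi <-> FCLP_con phi)) /\
  ((BLP R <-> CBLP R) /\ (CBLP R <-> FCLP R)).
Proof.
have eqs (phi : con R) :
    (BLP_con phi <-> CBLP_con phi) /\ (CBLP_con phi <-> FCLP_con phi).
  by split; [exact: BLP_CBLP_con|exact: CBLP_FCLP_con].
split; first by move=> F; split.
split=> //; split; split=> lift phi; have [e1 e2] := eqs phi.
- exact/e1.
- exact/e1.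
- exact/e2.
- exact/e2.
Qed.
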